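(* The original complex signal $z(t)=z_r(t)+\boldsymbol{\xi}z_i(t)$ is the simplex part of its corresponding hyperanalytic signal $h(t)$. The perplex part is the orthogonal or ''quadrature'' component, $o(t)$. They are obtained by $$z(t)=\frac12\left(h(t)-\boldsymbol{\xi}\,h(t)\,\boldsymbol{\xi}\right),\qquad o(t)=\frac12\left(h(t)+\boldsymbol{\xi}\,h(t)\,\boldsymbol{\xi}\right).$$
   Context: $\boldsymbol{\xi},\boldsymbol{\mu}$ are unit pure quaternions (modulus 1, zero scalar part) that are orthogonal to each other (the scalar part of $\boldsymbol{\xi}\boldsymbol{\mu}$ is zero), so that $(1,\boldsymbol{\xi},\boldsymbol{\mu},\boldsymbol{\xi}\boldsymbol{\mu})$ is a quaternion basis. $z_r,z_i$ are real-valued. The quaternion Fourier transform of $z(t)$ with axis $\boldsymbol{\mu}$ is $Z_{\boldsymbol{\mu}}(\nu)=\mathcal{F}_{\boldsymbol{\mu}}[z(t)]=\int_{-\infty}^{\infty}z(t)e^{-\boldsymbol{\mu}2\pi\nu t}\,\mathrm{d}t$, with inverse $\mathcal{F}_{\boldsymbol{\mu}}^{-1}[X(\nu)]=\int_{-\infty}^{\infty}X(\nu)e^{\boldsymbol{\mu}2\pi\nu t}\,\mathrm{d}\nu$. The hypercomplex analogue of the Hilbert transform is $\mathcal{H}_{\boldsymbol{\mu}}[z(t)]=\mathcal{F}_{\boldsymbol{\mu}}^{-1}[-\boldsymbol{\mu}\,\mathrm{sign}(\nu)Z_{\boldsymbol{\mu}}(\nu)]$; it has the form $o_r(t)+\boldsymbol{\xi}o_i(t)$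 with $o_r,o_i$ real-valued, and $o(t)=o_r(t)+\boldsymbol{\xi}o_i(t)$ denotes this orthogonal signal. The hyperanalytic signal of $z(t)$ is $h(t)=z(t)+\boldsymbol{\mu}\,\mathcal{H}_{\boldsymbol{\mu}}[z(t)]$, that is, $h(t)=z(t)+\boldsymbol{\mu}\,o(t)$. The words ''simplex part'' and ''perplex part'' name the two components of $h(t)$ with respect to $\boldsymbol{\xi}$ that are given by the two displayed formulas, respectively.
   Formalization: The second formula is false as printed whenever o(t) ≠ 0, since ξhξ = −z + μo; it is corrected to μ o(t) = ½(h(t) + ξ h(t) ξ), so the perplex part is μ o(t) with o(t) its coefficient. Convergence of the transform integrals is assumed. *)

(* Defs.v *)
From HB Require Import structures.
From mathcomp Require Import all_boot all_order all_algebra ring.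
From mathcomp Require Import all_classical all_reals all_analysis.

Set Implicit Arguments.
Unset Strict Implicit.
Unset Printing Implicit Defensive.

Import Order.TTheory GRing.Theory Num.Theory.
Import numFieldNormedType.Exports.

Local Open Scope classical_set_scope.
Local Open Scope ring_scope.

Record quat (R : Type) := Quat { q0 : R; q1 : R; q2 : R; q3 : R }.

Arguments q0 {R} q.
Arguments q1 {R} q.
Arguments q2 {R} q.
Arguments q3 {R} q.

Section QuatAlgebra.
Variable R : comNzRingType.
Implicit Types p q r : quat R.

Definition quat_to_prod q : R * R * R * R := (q0 q, q1 q, q2 q, q3 q).
Definition quat_of_prod (x : R * R * R * R) : quat R :=
  Quat x.1.1.1 x.1.1.2 x.1.2 x.2.
Lemma quat_to_prodK : cancel quat_to_prod quat_of_prod.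
Proof. by case. Qed.

HB.instance Definition _ := Choice.copy (quat R) (can_type quat_to_prodK).

Lemma quat_ext p q :
  q0 p = q0 q -> q1 p = q1 q -> q2 p = q2 q -> q3 p = q3 q -> p = q.
Proof. by case: p q => ? ? ? ? [] ? ? ? ? /= -> -> -> ->. Qed.

Definition addq p q :=
  Quat (q0 p + q0 q) (q1 p + q1 q) (q2 p + q2 q) (q3 p + q3 q).
Definition oppq p := Quat (- q0 p) (- q1 p) (- q2 p) (- q3 p).
Definition scaleq (a : R) p := Quat (a * q0 p) (a * q1 p) (a * q2 p) (a * q3 p).

(* Hamilton's product: i^2 = j^2 = k^2 = ijk = -1. *)
Definition mulq p q :=
  Quat (q0 p * q0 q - q1 p * q1 q - q2 p * q2 q - q3 p * q3 q)
       (q0 p * q1 q + q1 p * q0 q + q2 p * q3 q - q3 p * q2 q)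
       (q0 p * q2 q - q1 p * q3 q + q2 p * q0 q + q3 p * q1 q)
       (q0 p * q3 q + q1 p * q2 q - q2 p * q1 q + q3 p * q0 q).

Fact addqA : associative addq.
Proof. by move=> p q r; apply: quat_ext => /=; ring. Qed.
Fact addqC : commutative addq.
Proof. by move=> p q; apply: quat_ext => /=; ring. Qed.
Fact add0q : left_id (Quat 0 0 0 0) addq.
Proof. by move=> p; apply: quat_ext => /=; ring. Qed.
Fact addNq : left_inverse (Quat 0 0 0 0) oppq addq.
Proof. by move=> p; apply: quat_ext => /=; ring. Qed.

HB.instance Definition _ :=
  GRing.isZmodule.Build (quat R) addqA addqC add0q addNq.

Fact mulqA : associative mulq.
Proof. by move=> p q r; apply: quat_ext => /=; ring. Qed.
Fact mul1q : left_id (Quat 1 0 0 0) mulq.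
Proof. by move=> p; apply: quat_ext => /=; ring. Qed.
Fact mulq1 : right_id (Quat 1 0 0 0) mulq.
Proof. by move=> p; apply: quat_ext => /=; ring. Qed.
Fact mulqDl : left_distributive mulq +%R.
Proof. by move=> p q r; apply: quat_ext => /=; ring. Qed.
Fact mulqDr : right_distributive mulq +%R.
Proof. by move=> p q r; apply: quat_ext => /=; ring. Qed.
Fact oneq_neq0 : Quat 1 0 0 0 != 0 :> quat R.
Proof. by apply/eqP => -[] /eqP; rewrite oner_eq0. Qed.

HB.instance Definition _ := GRing.Zmodule_isNzRing.Build (quat R)
  mulqA mul1q mulq1 mulqDl mulqDr oneq_neq0.

Fact scaleqA a b p : scaleq a (scaleq b p) = scaleq (a * b) p.
Proof. by apply: quat_ext => /=; ring. Qed.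
Fact scale1q : left_id 1 scaleq.
Proof. by move=> p; apply: quat_ext => /=; ring. Qed.
Fact scaleqDr : right_distributive scaleq +%R.
Proof. by move=> a p q; apply: quat_ext => /=; ring. Qed.
Fact scaleqDl p : {morph scaleq^~ p : a b / a + b}.
Proof. by move=> a b; apply: quat_ext => /=; ring. Qed.

HB.instance Definition _ := GRing.Zmodule_isLmodule.Build R (quat R)
  scaleqA scale1q scaleqDr scaleqDl.

Fact scaleqAl (a : R) p q : a *: (p * q) = (a *: p) * q.
Proof. by apply: quat_ext => /=; ring. Qed.
Fact scaleqAr (a : R) p q : a *: (p * q) = p * (a *: q).
Proof. by apply: quat_ext => /=; ring. Qed.

HB.instance Definition _ := GRing.Lmodule_isLalgebra.Build R (quat R) scaleqAl.
HB.instance Definition _ := GRing.Lalgebra_isAlgebra.Build R (quat R) scaleqAr.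

End QuatAlgebra.

Section HyperanalyticSignal.
Variable R : realType.
Implicit Types (xi mu q : quat R) (z : R -> quat R).

Notation leb := (@lebesgue_measure R).

Definition qmod q : R :=
  Num.sqrt (q0 q ^+ 2 + q1 q ^+ 2 + q2 q ^+ 2 + q3 q ^+ 2).

Definition unit_pure q : Prop := qmod q = 1 /\ q0 q = 0.

(* Limits and integrals of quaternion-valued functions are componentwise. *)
Definition qmap (F : (R -> R) -> R) z : quat R :=
  Quat (F (q0 \o z)) (F (q1 \o z)) (F (q2 \o z)) (F (q3 \o z)).

Definition qall (P : (R -> R) -> Prop) z : Prop :=
  [/\ P (q0 \o z), P (q1 \o z), P (q2 \o z) & P (q3 \o z)].

(* The exponential series. *)
Definition qexp q : quat R :=
  let e n := n`!%:R^-1 *: q ^+ n in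
  Quat (lim (series (fun n => q0 (e n)) @ \oo))
       (lim (series (fun n => q1 (e n)) @ \oo))
       (lim (series (fun n => q2 (e n)) @ \oo))
       (lim (series (fun n => q3 (e n)) @ \oo)).

(* The integral over ]-oo, +oo[ is the limit of the Lebesgue integrals over
   [-A, A] as A -> +oo; it is the Lebesgue integral whenever the integrand is
   Lebesgue integrable, and it also covers conditionally convergent Fourier
   integrals. It is only meaningful when the integral converges. *)
Definition sym_integral (f : R -> R) (A : R) : R :=
  Rintegral leb `[- A, A] f.

Definition integral_converges (f : R -> R) : Prop :=
  (forall A : R, leb.-integrable `[- A, A] (EFin \o f)) /\
  cvg (sym_integral f A @[A --> +oo]).

Definition integralR (f : R -> R) : R := lim (sym_integral f A @[A --> +oo]).

Definition qintegral z : quat R := qmap integralR z.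
Definition qintegral_converges z : Prop := qall integral_converges z.

Definition qft_integrand mu z (nu t : R) : quat R :=
  z t * qexp (- (mu * (2 * pi * nu * t)%:A)).

Definition qft mu z (nu : R) : quat R := qintegral (qft_integrand mu z nu).

Definition iqft_integrand mu (X : R -> quat R) (t nu : R) : quat R :=
  X nu * qexp (mu * (2 * pi * nu * t)%:A).

Definition iqft mu (X : R -> quat R) (t : R) : quat R :=
  qintegral (iqft_integrand mu X t).

Definition hilbert_spectrum mu z (nu : R) : quat R :=
  - mu * (Num.sg nu)%:A * qft mu z nu.

Definition hilbert mu z (t : R) : quat R := iqft mu (hilbert_spectrum mu z) t.

(* Exceptional frequencies of measure zero do not affect the inverse
   transform. *)
Definition qft_exists mu z : Prop :=
  {ae leb, forall nu, qintegral_converges (qft_integrand mu z nu)}.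

Definition hilbert_exists mu z (t : R) : Prop :=
  qintegral_converges (iqft_integrand mu (hilbert_spectrum mu z) t).

Definition hyperanalytic mu z (t : R) : quat R := z t + mu * hilbert mu z t.

Definition csignal xi (a b : R -> R) (t : R) : quat R :=
  (a t)%:A + xi * (b t)%:A.

Definition simplex xi q : quat R := 2^-1 *: (q - xi * q * xi).
Definition perplex xi q : quat R := 2^-1 *: (q + xi * q * xi).

Lemma unit_pure_sqr q : unit_pure q -> q * q = -1.
Proof.
case: q => a b c d [/= h a0]; rewrite a0 in h *.
have {}h : b ^+ 2 + c ^+ 2 + d ^+ 2 = 1.
  have := congr1 (fun x => x ^+ 2) h.
  rewrite /qmod /= expr0n /= add0r sqr_sqrtr ?expr1n//.
  by rewrite !addr_ge0 ?sqr_ge0.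
by apply: quat_ext => /=; rewrite ?oppr0 -?h; ring.
Qed.

Lemma orthogonal_anticomm xi mu : unit_pure xi -> unit_pure mu ->
  q0 (xi * mu) = 0 -> xi * mu = - (mu * xi).
Proof.
case: xi mu => [a b c d] [a' b' c' d'] [_ /= ->] [_ /= ->].
rewrite mul0r !sub0r => h.
apply: quat_ext => /=; [|by ring..].
transitivity (- b * b' - c * c' - d * d' : R); first by ring.
transitivity (b' * b + c' * c + d' * d : R); last by ring.
by rewrite mulNr h [X in _ = X](_ : _ = - (- (b * b') - c * c' - d * d'));
  [rewrite h oppr0|ring].
Qed.

(* For o in the plane (1, xi), the perplex component of z + mu o is mu o, in
   the plane (mu, mu xi); it is equal to o itself only when o = 0. *)
Lemma perplex_coef xi mu (a b c d : R) :
  unit_pure xi -> unit_pure mu -> q0 (xi * mu) = 0 ->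
  let o := c%:A + xi * d%:A in
  let h := a%:A + xi * b%:A + mu * o in
  [/\ simplex xi h = a%:A + xi * b%:A, perplex xi h = mu * o &
      o = perplex xi h -> o = 0].
Proof.
move=> hxi hmu hort o h.
have x2 := unit_pure_sqr hxi; have m2 := unit_pure_sqr hmu.
have xm := orthogonal_anticomm hxi hmu hort.
have xo : o * xi = xi * o.
  by rewrite /o !mulr_algr mulrDl mulrDr -!scalerAl -!scalerAr mul1r mulr1.
have xz : (a%:A + xi * b%:A) * xi = xi * (a%:A + xi * b%:A).
  by rewrite !mulr_algr mulrDl mulrDr -!scalerAl -!scalerAr mul1r mulr1.
have xmo : xi * (mu * o) * xi = mu * o.
  rewrite mulrA xm -mulrA xo mulNr -mulrA [xi * (xi * o)]mulrA x2.
  by rewrite mulN1r mulrN opprK.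
have xhx : xi * h * xi = - (a%:A + xi * b%:A) + mu * o.
  by rewrite /h mulrDr mulrDl xmo -mulrA xz mulrA x2 mulN1r.
have half (x : quat R) : 2^-1 *: (x + x) = x.
  by rewrite scalerDr -scalerDl -[2^-1]mul1r -splitr scale1r.
have eqp : perplex xi h = mu * o.
  by rewrite /perplex xhx /h addrACA subrr add0r half.
split => //.
  by rewrite /simplex xhx /h opprD opprK addrACA subrr addr0 half.
rewrite eqp => e; have e2 : o = - o by rewrite -[RHS]mulN1r -m2 -mulrA -!e.
by rewrite -(half o) {2}e2 subrr scaler0.
Qed.

End HyperanalyticSignal.

(* Main.v *)
Require Import Defs.
From HB Require Import structures.
From mathcomp Require Import all_boot all_order all_algebra ring.
From mathcomp Require Import all_classical all_reals all_analysis.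
From mathcomp Require Import measurable_realfun.
Local Open Scope ring_scope.

(** Conjugation [s q = - xi q xi] is an algebra automorphism that fixes the
plane of [1, xi] and, by orthogonality, sends [mu] to [- mu], hence
[e^(mu a)] to [e^(- mu a)]. Since [s] commutes with integration, the transform
of [z] satisfies [s (Z nu) = Z (- nu)]. As [sign] is odd, the integrand of the
inverse transform that defines the Hilbert transform has the same symmetry
(almost everywhere), so its integrals over the symmetric intervals [[-A, A]]
are fixed by [s]. The Hilbert transform therefore commutes with [xi], that is,
it lies in the plane of [1, xi]. *)

Import Order.TTheory GRing.Theory Num.Theory.
Import numFieldNormedType.Exports.
Local Open Scope classical_set_scope.

(** When [xi * xi = -1], the inverse of [xi] is [- xi], so this is the inner automorphism q -> xi q
    xi^-1. *)
Definition conjby {R : comNzRingType} (xi q : quat R) : quat R :=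
  - (xi * q * xi).

(** * Conjugation as a linear automorphism *)

Section Conjby.
Variables (R : comNzRingType) (xi : quat R).

Fact conjby_is_linear : linear (conjby xi).
Proof.
move=> a p q; rewrite /conjby mulrDr mulrDl -scalerAr -scalerAl opprD.
by rewrite scalerN.
Qed.

HB.instance Definition _ :=
  GRing.isLinear.Build R (quat R) (quat R) *:%R (conjby xi) conjby_is_linear.

Hypothesis xi2 : xi * xi = -1.

Lemma conjbyM (p q : quat R) : conjby xi (p * q) = conjby xi p * conjby xi q.
Proof.
rewrite /conjby mulrNN.
have -> : xi * p * xi * (xi * q * xi) = xi * p * (xi * xi) * q * xi.
  by rewrite !mulrA.
by rewrite xi2 mulrN1 !mulNr !mulrA.
Qed.

Lemma conjby1 : conjby xi 1 = 1.
Proof. by rewrite /conjby mulr1 xi2 opprK. Qed.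

Lemma conjby_self : conjby xi xi = xi.
Proof. by rewrite /conjby xi2 mulN1r opprK. Qed.

Lemma conjby_anticomm (mu : quat R) : xi * mu = - (mu * xi) ->
  conjby xi mu = - mu.
Proof. by move=> e; rewrite /conjby e mulNr -mulrA xi2 opprK mulrN1. Qed.

Lemma conjby_fixed_comm (q : quat R) : conjby xi q = q -> xi * q = q * xi.
Proof.
move=> e; rewrite -[in RHS]e /conjby mulNr -[in RHS](mulrA (xi * q)) xi2.
by rewrite mulrN1 opprK.
Qed.

End Conjby.

Lemma conjby_csignal (R : realType) (xi : quat R) (a b : R -> R) (t : R) :
  xi * xi = -1 -> conjby xi (csignal xi a b t) = csignal xi a b t.
Proof.
move=> xi2; rewrite /csignal !mulr_algr linearD !linearZ/= conjby1//.
by rewrite conjby_self.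
Qed.

(** Commuting with [xi] forces the vector parts of [xi] and [q] to have zero cross product, hence to
    be parallel; the coefficient [- q0 (xi * q)] is their dot product. *)
Lemma comm_unit_pure (R : realType) (xi q : quat R) : unit_pure xi ->
  xi * q = q * xi -> q = (q0 q)%:A + xi * (- q0 (xi * q))%:A.
Proof.
move=> hxi e; have x2 := unit_pure_sqr hxi; have x0 : q0 xi = 0 by case: hxi.
(* Left multiplication by [- xi], the inverse of [xi], turns this identity into the claim. *)
suff xq : xi * q = q0 q *: xi + (q0 (xi * q))%:A.
  rewrite mulr_algr scaleNr -[LHS]opprK -[in LHS](mul1r q) -mulNr -x2 -mulrA.
  rewrite {1}xq mulrDr -scalerAr x2 mulr_algr.
  by rewrite opprD scalerN opprK.
move: e x0 {hxi x2}; case: xi => x0 x1 x2 x3; case: q => a b c d /= e x00.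
move: e; rewrite x00 => -[_ e1 e2 e3].
(* [k1], [k2] and [k3] treat the coordinates of the cross product; [xi * q] and [q * xi] differ by
   twice that vector, whence the cancelled factor 2. *)
have k1 : x2 * d - x3 * c = 0.
  apply: (@mulfI _ (2 : R)); rewrite ?pnatr_eq0// mulr0.
  by transitivity ((0 * b + x1 * a + x2 * d - x3 * c) -
      (a * x1 + b * 0 + c * x3 - d * x2)); [ring|rewrite e1 subrr].
have k2 : x3 * b - x1 * d = 0.
  apply: (@mulfI _ (2 : R)); rewrite ?pnatr_eq0// mulr0.
  by transitivity ((0 * c - x1 * d + x2 * a + x3 * b) -
      (a * x2 - b * x3 + c * 0 + d * x1)); [ring|rewrite e2 subrr].
have k3 : x1 * c - x2 * b = 0.
  apply: (@mulfI _ (2 : R)); rewrite ?pnatr_eq0// mulr0.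
  by transitivity ((0 * d + x1 * c - x2 * b + x3 * a) -
      (a * x3 + b * x2 - c * x1 + d * 0)); [ring|rewrite e3 subrr].
apply: quat_ext => /=; first by ring.
- by transitivity (x1 * a + (x2 * d - x3 * c)); [ring|rewrite k1; ring].
- by transitivity (x2 * a + (x3 * b - x1 * d)); [ring|rewrite k2; ring].
- by transitivity (x3 * a + (x1 * c - x2 * b)); [ring|rewrite k3; ring].
Qed.

(** * Euler's formula for quaternions *)

Section QuaternionExponential.
Variable R : realType.
Implicit Types mu : quat R.

(** Even powers of [mu] are real signs and odd powers are signs times [mu], so the terms split as
    for the complex exponential. *)
Lemma exp_coeff_unit_pure mu (a : R) n : mu * mu = -1 ->
  n`!%:R^-1 *: (mu * a%:A) ^+ n =
  cos_coeff a n *: 1 + sin_coeff a n *: mu.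
Proof.
move=> m2; rewrite mulr_algr exprZn.
have powD k : mu ^+ k.*2 = ((-1) ^+ k)%:A.
  rewrite -muln2 mulnC exprM expr2 m2.
  by rewrite -[in RHS]in_algE rmorphXn rmorphN1.
(* Write [n] as its parity plus twice [n./2]; in each case one of the two coefficients vanishes. *)
rewrite /cos_coeff /sin_coeff /= -(odd_double_half n).
move: (odd n) n./2 => [] m.
  rewrite add1n /= odd_double /= doubleK (exprS mu) powD mulr_algr.
  by rewrite !mul0r scale0r add0r !scalerA mul1r; congr (_ *: _); ring.
rewrite add0n odd_double /= doubleK powD !mul0r scale0r addr0 !scalerA mul1r.
by rewrite -exprnP; congr (_ *: _); ring.
Qed.

(** [u] and [v] stand for a fixed coordinate of 1 and of [mu], as [qexp] takes its limit coordinate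
    by coordinate. *)
Lemma lim_series_cos_sin (a u v : R) :
  lim (series (fun n => cos_coeff a n * u + sin_coeff a n * v) @ \oo) =
  cos a * u + sin a * v.
Proof.
have cc := @is_cvg_series_cos_coeff R a.
have cs := @is_cvg_series_sin_coeff R a.
rewrite (_ : (fun n => _) = u *: cos_coeff a + v *: sin_coeff a); last first.
  by apply/funext => n; rewrite mulrC [sin_coeff a n * v]mulrC.
rewrite lim_seriesD; try exact: is_cvg_seriesZ.
(* Unlocking exposes [cos] and [sin] as the limits of their power series. *)
by rewrite !lim_seriesZ// !unlock; congr (_ + _); rewrite mulrC.
Qed.

Lemma qexp_unit_pure mu (a : R) : mu * mu = -1 ->
  qexp (mu * a%:A) = cos a *: 1 + sin a *: mu.
Proof.
move=> m2; rewrite /qexp.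
under eq_fun do rewrite exp_coeff_unit_pure//.
under [in X in Quat _ X]eq_fun do rewrite exp_coeff_unit_pure//.
under [in X in Quat _ _ X]eq_fun do rewrite exp_coeff_unit_pure//.
under [in X in Quat _ _ _ X]eq_fun do rewrite exp_coeff_unit_pure//.
by apply: quat_ext; rewrite /= lim_series_cos_sin.
Qed.

Lemma qexpN_unit_pure mu (a : R) : mu * mu = -1 ->
  qexp (- (mu * a%:A)) = qexp (mu * (- a)%:A).
Proof. by move=> m2; rewrite scaleNr mulrN. Qed.

Lemma conjby_qexp (xi mu : quat R) (a : R) : xi * xi = -1 -> mu * mu = -1 ->
  xi * mu = - (mu * xi) ->
  conjby xi (qexp (mu * a%:A)) = qexp (mu * (- a)%:A).
Proof.
move=> x2 m2 xm; rewrite !qexp_unit_pure// linearD !linearZ/= conjby1//.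
by rewrite (conjby_anticomm _ _ x2 _ xm) cosN sinN scalerN scaleNr.
Qed.

End QuaternionExponential.

(** * Integrals over symmetric intervals *)

Section SymmetricIntegral.
Variable R : realType.
Implicit Types (f g : R -> R) (z w : R -> quat R).
Notation leb := (@lebesgue_measure R).

(** Linearity holds on each [[- A, A]] and passes to the limit; convergence is carried along because
    [integralR] is meaningful only with it. *)
Lemma integral_converges_linear c f g :
    integral_converges f -> integral_converges g ->
  integral_converges (fun x => c * f x + g x) /\
  integralR (fun x => c * f x + g x) = c * integralR f + integralR g.
Proof.
move=> [fi fc] [gi gc].
have cfi A : leb.-integrable `[- A, A] (EFin \o (fun x => c * f x)).
  have := @integrableZl _ _ _ leb `[- A, A] (measurable_itv _) c _ (fi A).
  by apply: eq_integrable.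
have E : sym_integral (fun x => c * f x + g x) =
    (fun A => c * sym_integral f A + sym_integral g A).
  apply/funext => A; rewrite /sym_integral RintegralD//.
  by rewrite RintegralZl.
have cv : sym_integral (fun x => c * f x + g x) A @[A --> +oo] -->
    c * integralR f + integralR g.
  by rewrite E; apply: cvgD => //; apply: cvgM => //; exact: cvg_cst.
split; last exact: cvg_lim cv.
split; last by apply/cvg_ex; eexists; exact: cv.
move=> A; have := @integrableD _ _ _ leb `[- A, A] (measurable_itv _) _ _ (cfi A) (gi A).
by apply: eq_integrable.
Qed.

(** Each coordinate of a linear image of a quaternion is a combination of its four real coordinates,
    of this shape. *)
Lemma integral_converges_lincomb4 c0 c1 c2 c3 f0 f1 f2 f3 :
    integral_converges f0 -> integral_converges f1 ->
    integral_converges f2 -> integral_converges f3 ->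
  let f x := c0 * f0 x + (c1 * f1 x + (c2 * f2 x + c3 * f3 x)) in
  integral_converges f /\
  integralR f = c0 * integralR f0 + (c1 * integralR f1 +
    (c2 * integralR f2 + c3 * integralR f3)).
Proof.
move=> h0 h1 h2 h3 f.
have [k3 e3] : integral_converges (fun x => c3 * f3 x) /\
    integralR (fun x => c3 * f3 x) = c3 * integralR f3.
  (* The zero function arises as [-1 * f3 + f3]; it then fills the second slot of the linearity
     lemma. *)
  have [hz ez] : integral_converges (fun=> 0 : R) /\
      integralR (fun=> 0 : R) = 0.
    have [] := @integral_converges_linear (-1) f3 f3 h3 h3.
    rewrite mulN1r addNr; under eq_fun do rewrite mulN1r addNr.
    by [].
  have := @integral_converges_linear c3 _ _ h3 hz.
  by rewrite ez addr0; under eq_fun do rewrite addr0.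
have [k2 e2] := @integral_converges_linear c2 _ _ h2 k3.
have [k1 e1] := @integral_converges_linear c1 _ _ h1 k2.
have [k0 e0] := @integral_converges_linear c0 _ _ h0 k1.
by split => //; rewrite e0 e1 e2 e3.
Qed.

Lemma quat_linearE (L : {linear quat R -> quat R}) (q : quat R) :
  L q = q0 q *: L (Quat 1 0 0 0) + (q1 q *: L (Quat 0 1 0 0) +
    (q2 q *: L (Quat 0 0 1 0) + q3 q *: L (Quat 0 0 0 1))).
Proof.
by rewrite -!linearZ -!linearD; congr (L _); apply: quat_ext => /=; ring.
Qed.

Lemma qintegral_linear (L : {linear quat R -> quat R}) z :
    qintegral_converges z ->
  qintegral_converges (L \o z) /\ qintegral (L \o z) = L (qintegral z).
Proof.
move=> [z0 z1 z2 z3].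
(* [k] will be each of the four coordinates; its linearity expresses [k (L q)] through the values of
   [k \o L] on the basis. *)
have comp (k : quat R -> R) :
    (forall p q, k (p + q) = k p + k q) ->
    (forall a q, k (a *: q) = a * k q) ->
    integral_converges (k \o (L \o z)) /\
    integralR (k \o (L \o z)) = k (L (qintegral z)).
  move=> kD kZ.
  have := @integral_converges_lincomb4 (k (L (Quat 1 0 0 0)))
    (k (L (Quat 0 1 0 0))) (k (L (Quat 0 0 1 0))) (k (L (Quat 0 0 0 1)))
    _ _ _ _ z0 z1 z2 z3.
  rewrite (_ : (fun x => _) = k \o (L \o z)); last first.
    apply/funext => x /=; rewrite [in RHS]quat_linearE !kD !kZ.
    by rewrite ![_ * k _]mulrC.
  move=> /= [? ->]; split => //; rewrite [in RHS]quat_linearE !kD !kZ.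
  by rewrite ![_ * k _]mulrC.
have [? ?] := comp q0 (fun _ _ => erefl) (fun _ _ => erefl).
have [? ?] := comp q1 (fun _ _ => erefl) (fun _ _ => erefl).
have [? ?] := comp q2 (fun _ _ => erefl) (fun _ _ => erefl).
have [? ?] := comp q3 (fun _ _ => erefl) (fun _ _ => erefl).
by split; [split|apply: quat_ext].
Qed.

(** Lebesgue measure is invariant under negation and [[- A, A]] is its own preimage. The change of
    variables is made for nonnegative functions, then applied to the positive and negative parts. *)
Lemma integral_itv_reflection (f : R -> \bar R) (A : R) :
  measurable_fun (`[- A, A]%classic : set R) f ->
  (\int[leb]_(x in `[(- A)%R, A]) f x = \int[leb]_(x in `[(- A)%R, A]) f (- x)%R)%E.
Proof.
move=> mf.
have pre : (-%R : _ -> measurableTypeR R) @^-1` `[- A, A] = `[- A, A]%classic.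
  by rewrite opp_preimage_itvbndbnd/= opprK.
have pos (g : R -> \bar R) : measurable_fun (`[- A, A]%classic : set R) g ->
    (forall x, 0 <= g x)%E ->
    (\int[leb]_(x in `[(- A)%R, A]) g x =
     \int[leb]_(x in `[(- A)%R, A]) (g \o -%R) x)%E.
  move=> mg g0; rewrite -[in RHS]pre -ge0_integral_pushforward//=.
  by apply: eq_measure_integral => //= B mB BS; exact/esym/lebesgue_measureN.
rewrite integralE [in RHS]integralE; congr (_ - _)%E.
  rewrite pos; [by rewrite -funepos_comp|exact: measurable_funepos|by []].
by rewrite pos; [rewrite -funeneg_comp|exact: measurable_funeneg|].
Qed.

Lemma lebesgue_ae_imply (P Q : R -> Prop) : (forall x, P x -> Q x) ->
  {ae leb, forall x, P x} -> {ae leb, forall x, Q x}.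
Proof.
by move=> PQ; apply: negligibleS => x /= nQ Px; apply: nQ; exact: PQ.
Qed.

(** The integrals over each [[- A, A]] already agree, hence so do their limits. *)
Lemma integralR_reflection f g :
    integral_converges f -> integral_converges g ->
  {ae leb, forall x, f x = g (- x)} -> integralR f = integralR g.
Proof.
move=> [fi _] [gi _] fg; rewrite /integralR.
suff -> : sym_integral f = sym_integral g by [].
apply/funext => A; rewrite /sym_integral /Rintegral; congr fine.
have mf := measurable_int leb (fi A); have mg := measurable_int leb (gi A).
rewrite [in RHS]integral_itv_reflection//; apply: ae_eq_integral => //.
  have mo : measurable_fun (`[- A, A]%classic : set R) (-%R : R -> R).
    exact: oppr_measurable.
  refine (measurable_comp _ _ mg mo) => //.
  by move=> _ [x xA <-]; move: xA; rewrite /= !in_itv/= !lerN2 lerNl andbC.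
by move: fg; apply: lebesgue_ae_imply => x /= -> _.
Qed.

Lemma qintegral_reflection z w :
    qintegral_converges z -> qintegral_converges w ->
  {ae leb, forall x, z x = w (- x)} -> qintegral z = qintegral w.
Proof.
move=> [z0 z1 z2 z3] [w0 w1 w2 w3] zw.
by apply: quat_ext; apply: integralR_reflection => //;
  move: zw; apply: lebesgue_ae_imply => x /= ->.
Qed.

End SymmetricIntegral.

(** * Symmetry of the spectrum and of the Hilbert transform *)

Section HilbertSymmetry.
Variables (R : realType) (xi mu : quat R) (zr zi : R -> R).
Hypotheses (hxi : unit_pure xi) (hmu : unit_pure mu).
Hypothesis hort : q0 (xi * mu) = 0.
Let xi2 := unit_pure_sqr hxi.
Let mu2 := unit_pure_sqr hmu.
Let xm := orthogonal_anticomm hxi hmu hort.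
Let z := csignal xi zr zi.
Notation leb := (@lebesgue_measure R).

Lemma conjby_qft nu : qintegral_converges (qft_integrand mu z nu) ->
  conjby xi (qft mu z nu) = qft mu z (- nu).
Proof.
move=> /(qintegral_linear _ (conjby xi))[_ <-].
congr qintegral; apply/funext => t.
rewrite /= /qft_integrand (conjbyM _ _ xi2) (conjby_csignal _ _ _ _ _ xi2).
rewrite !(qexpN_unit_pure _ _ _ mu2) (conjby_qexp _ _ _ _ xi2 mu2 xm).
by rewrite mulrN mulNr.
Qed.

(** The sign from [conjby xi mu = - mu] is absorbed by the oddness of [Num.sg]. *)
Lemma conjby_hilbert_spectrum nu :
    qintegral_converges (qft_integrand mu z nu) ->
  conjby xi (hilbert_spectrum mu z nu) = hilbert_spectrum mu z (- nu).
Proof.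
move=> cv; rewrite /hilbert_spectrum conjbyM// conjby_qft// !mulr_algr.
rewrite linearZ/= (linearN (conjby xi))/= (conjby_anticomm _ _ xi2 _ xm).
by rewrite sgrN scaleNr scalerN.
Qed.

Lemma conjby_hilbert t : qft_exists mu z -> hilbert_exists mu z t ->
  conjby xi (hilbert mu z t) = hilbert mu z t.
Proof.
move=> zex hex; have [cv <-] := qintegral_linear _ (conjby xi) _ hex.
apply: qintegral_reflection => //.
(* The symmetry of the spectrum is known wherever the transform of [z] converges, hence at almost
   every frequency. *)
move: zex; apply: lebesgue_ae_imply => nu cvnu.
rewrite /= /iqft_integrand (conjbyM _ _ xi2) (conjby_hilbert_spectrum _ cvnu).
by rewrite (conjby_qexp _ _ _ _ xi2 mu2 xm) mulrN mulNr.
Qed.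

End HilbertSymmetry.

Theorem mainTheorem5 (R : realType) (xi mu : quat R)
    (hxi : unit_pure xi) (hmu : unit_pure mu) (hort : q0 (xi * mu) = 0)
    (zr zi : R -> R) :
  let z := csignal xi zr zi in
  let h := hyperanalytic mu z in
  qft_exists mu z ->
  exists o_r o_i : R -> R,
    let o := csignal xi o_r o_i in
    forall t : R, hilbert_exists mu z t ->
      [/\ hilbert mu z t = o t,
          z t = simplex xi (h t) &
          mu * o t = perplex xi (h t)].
Proof.
move=> z h zex.
(* These are the coordinates along 1 and [xi] given by [comm_unit_pure]. *)
exists (fun t => q0 (hilbert mu z t)), (fun t => - q0 (xi * hilbert mu z t)).
move=> o t hex.
have ho : hilbert mu z t = o t.
  apply: comm_unit_pure => //; apply: conjby_fixed_comm; first exact: unit_pure_sqr.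
  exact: conjby_hilbert.
(* With the Hilbert transform in the plane of 1 and [xi], both formulas are pointwise quaternion
   algebra. *)
have [] := perplex_coef (zr t) (zi t) (q0 (hilbert mu z t))
  (- q0 (xi * hilbert mu z t)) hxi hmu hort.
by split => //; rewrite /h /hyperanalytic ho.
Qed.
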